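(* Let $\mathcal{C}$ be a monoidal category with coequalizers, in which every object is coflat and left robust, and such that the unit object $\underline{1}$ is either a projective object or a left $\otimes$-generator of $\mathcal{C}$. If $i:R\to S$ is an algebra extension in $\mathcal{C}$ with $R$ a separable algebra, then $S$ is a separable algebra if and only if the algebra extension $i:R\to S$ is separable.
   Context: Monoidal categories are taken strict, with tensor product $\otimes$ and unit object $\underline{1}$; $m_A,\eta_A$ denote multiplication and unit of an algebra $A$. An object $X$ is coflat if both $X\otimes-$ and $-\otimes X$ preserve coequalizers. For an algebra $R$, a right $R$-module $(X,\nu^R_X)$ and a left $R$-module $(Y,\mu^R_Y)$, $q^R_{X,Y}:X\otimes Y\to X\otimes_RY$ is the coequalizer of $\nu^R_X\otimes\mathrm{Id}_Y$ and $\mathrm{Id}_X\otimes\mu^R_Y$. A left $R$-module $Y$ is left robust if for all objects $M$ of $\mathcal{C}$ and right $R$-modules $X$ the morphism $\theta'_{M,X,Y}:(M\otimes X)\otimes_RY\to M\otimes(X\otimes_RY)$ determined by $\theta'_{M,X,Y}q^R_{M\otimes X,Y}=\mathrm{Id}_M\otimes q^R_{X,Y}$ is an isomorphism; ''every object is left robust'' means that for every algebra $R$ in $\mathcal{C}$ every left $R$-module is left robust. An object $P$ is a left $\otimes$-generator of $\mathcal{C}$ if, whenever $f,g:Y\otimes Z\to W$ satisfy $f(\epsilon\otimes\mathrm{Id}_Z)=g(\epsilon\otimes\mathrm{Id}_Z)$ for all $\epsilon:P\to Y$, then $f=g$. An algebra $A$ is separable if there is an $A$-bimodule morphism $\gamma:A\to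 A\otimes A$ with $m_A\gamma=\mathrm{Id}_A$. An algebra extension $i:R\to S$ is an algebra morphism; $S$ is an $R$-bimodule via $i$. $S\otimes_RS$ is an $S$-bimodule via $\mu^S_{S\otimes_RS}(\mathrm{Id}_S\otimes q^R_{S,S})=q^R_{S,S}(m_S\otimes\mathrm{Id}_S)$ and $\nu^S_{S\otimes_RS}(q^R_{S,S}\otimes\mathrm{Id}_S)=q^R_{S,S}(\mathrm{Id}_S\otimes m_S)$, and $m^R_S:S\otimes_RS\to S$ is determined by $m^R_Sq^R_{S,S}=m_S$. The extension $i$ is separable if there is $e:\underline{1}\to S\otimes_RS$ in $\mathcal{C}$ with $\mu^S_{S\otimes_RS}(\mathrm{Id}_S\otimes e)=\nu^S_{S\otimes_RS}(e\otimes\mathrm{Id}_S)$ and $m^R_Se=\eta_S$. *)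

(* Defs.v *)
From Corelib Require Import ssreflect.
From Stdlib Require Import ClassicalEpsilon.

Set Implicit Arguments.
Unset Strict Implicit.
Unset Printing Implicit Defensive.

Declare Scope cat_scope.
Delimit Scope cat_scope with cat.
Local Open Scope cat_scope.

Record category := Category {
  obj :> Type;
  hom : obj -> obj -> Type;
  idm : forall X : obj, hom X X;
  comp : forall X Y Z : obj, hom Y Z -> hom X Y -> hom X Z;
  compA : forall (X Y Z W : obj) (h : hom Z W) (g : hom Y Z) (f : hom X Y),
    comp h (comp g f) = comp (comp h g) f;
  comp1m : forall (X Y : obj) (f : hom X Y), comp (idm Y) f = f;
  compm1 : forall (X Y : obj) (f : hom X Y), comp f (idm X) = f
}.

Arguments hom {c} X Y.
Arguments idm {c} X.
Arguments comp {c X Y Z} g f.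

Notation "g ∘ f" := (comp g f) (at level 40, left associativity) : cat_scope.

Definition is_iso (C : category) (X Y : C) (f : hom X Y) : Prop :=
  exists g : hom Y X, g ∘ f = idm X /\ f ∘ g = idm Y.

Definition epi (C : category) (X Y : C) (f : hom X Y) : Prop :=
  forall (Z : C) (g h : hom Y Z), g ∘ f = h ∘ f -> g = h.

Definition projective (C : category) (P : C) : Prop :=
  forall (X Y : C) (p : hom X Y), epi p ->
  forall f : hom P Y, exists g : hom P X, p ∘ g = f.

Record is_coequalizer (C : category) (X Y Q : C)
    (f g : hom X Y) (q : hom Y Q) : Prop := IsCoequalizer {
  coeq_cond : q ∘ f = q ∘ g;
  coeq_univ : forall (Z : C) (h : hom Y Z), h ∘ f = h ∘ g ->
    exists! k : hom Q Z, k ∘ q = h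
}.

Definition coeq_desc (C : category) (X Y Q : C) (f g : hom X Y) (q : hom Y Q)
    (Hq : is_coequalizer f g q) (Z : C) (h : hom Y Z)
    (Hh : h ∘ f = h ∘ g) : hom Q Z :=
  proj1_sig (constructive_indefinite_description _ (coeq_univ Hq Hh)).

Lemma coeq_descE (C : category) (X Y Q : C) (f g : hom X Y) (q : hom Y Q)
    (Hq : is_coequalizer f g q) (Z : C) (h : hom Y Z) (Hh : h ∘ f = h ∘ g) :
  coeq_desc Hq Hh ∘ q = h.
Proof.
rewrite /coeq_desc.
by case: (constructive_indefinite_description _ _) => k [].
Qed.

Lemma coeq_desc_unique (C : category) (X Y Q : C) (f g : hom X Y)
    (q : hom Y Q) (Hq : is_coequalizer f g q) (Z : C) (h : hom Y Z)
    (Hh : h ∘ f = h ∘ g) (k : hom Q Z) :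
  k ∘ q = h -> k = coeq_desc Hq Hh.
Proof.
rewrite /coeq_desc.
case: (constructive_indefinite_description _ _) => k' [_ Hk'] Hk /=.
by rewrite (Hk' _ Hk).
Qed.

Record coequalizer (C : category) (X Y : C) (f g : hom X Y) := Coequalizer {
  coeq_obj : C;
  coeq_map : hom Y coeq_obj;
  coeqP : is_coequalizer f g coeq_map
}.

(** A category with coequalizers comes with a choice of a coequalizer for each
    parallel pair. *)
Definition coequalizers (C : category) : Type :=
  forall (X Y : C) (f g : hom X Y), coequalizer f g.

(** Strictness is not required: the associativity and unit constraints are
    explicit, and strict monoidal categories are those where they are
    identities. *)
Record monoidal_category := MonoidalCategory {
  mcat :> category;
  tens : mcat -> mcat -> mcat;
  tensm : forall X Y X' Y' : mcat,
    hom X X' -> hom Y Y' -> hom (tens X Y) (tens X' Y');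
  unit_obj : mcat;
  assoc : forall X Y Z : mcat, hom (tens (tens X Y) Z) (tens X (tens Y Z));
  assoc_inv : forall X Y Z : mcat, hom (tens X (tens Y Z)) (tens (tens X Y) Z);
  lunit : forall X : mcat, hom (tens unit_obj X) X;
  lunit_inv : forall X : mcat, hom X (tens unit_obj X);
  runit : forall X : mcat, hom (tens X unit_obj) X;
  runit_inv : forall X : mcat, hom X (tens X unit_obj);
  tensm1 : forall X Y : mcat, tensm (idm X) (idm Y) = idm (tens X Y);
  tensm_comp : forall (X Y X' Y' X'' Y'' : mcat)
    (f' : hom X' X'') (g' : hom Y' Y'') (f : hom X X') (g : hom Y Y'),
    tensm (f' ∘ f) (g' ∘ g) = tensm f' g' ∘ tensm f g;
  assocK : forall X Y Z : mcat, assoc_inv X Y Z ∘ assoc X Y Z = idm _;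
  assoc_invK : forall X Y Z : mcat, assoc X Y Z ∘ assoc_inv X Y Z = idm _;
  lunitK : forall X : mcat, lunit_inv X ∘ lunit X = idm _;
  lunit_invK : forall X : mcat, lunit X ∘ lunit_inv X = idm _;
  runitK : forall X : mcat, runit_inv X ∘ runit X = idm _;
  runit_invK : forall X : mcat, runit X ∘ runit_inv X = idm _;
  assoc_nat : forall (X Y Z X' Y' Z' : mcat)
    (f : hom X X') (g : hom Y Y') (h : hom Z Z'),
    assoc X' Y' Z' ∘ tensm (tensm f g) h =
    tensm f (tensm g h) ∘ assoc X Y Z;
  lunit_nat : forall (X X' : mcat) (f : hom X X'),
    lunit X' ∘ tensm (idm unit_obj) f = f ∘ lunit X;
  runit_nat : forall (X X' : mcat) (f : hom X X'),
    runit X' ∘ tensm f (idm unit_obj) = f ∘ runit X;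
  pentagon : forall X Y Z W : mcat,
    assoc X Y (tens Z W) ∘ assoc (tens X Y) Z W =
    tensm (idm X) (assoc Y Z W) ∘ assoc X (tens Y Z) W ∘
      tensm (assoc X Y Z) (idm W);
  triangle : forall X Y : mcat,
    tensm (idm X) (lunit Y) ∘ assoc X unit_obj Y = tensm (runit X) (idm Y)
}.

Arguments tens {m} X Y.
Arguments tensm {m X Y X' Y'} f g.
Arguments assoc {m} X Y Z.
Arguments assoc_inv {m} X Y Z.
Arguments lunit {m} X.
Arguments lunit_inv {m} X.
Arguments runit {m} X.
Arguments runit_inv {m} X.

Notation "X ⊗ Y" := (tens X Y) (at level 35, right associativity) : cat_scope.
Notation "f ⊠ g" := (tensm f g) (at level 35, right associativity) : cat_scope.

Section MonoidalLemmas.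

Variable C : monoidal_category.
Implicit Types X Y Z W : C.

Lemma comp_congl X Y Z (g g' : hom Y Z) (f : hom X Y) :
  g = g' -> g ∘ f = g' ∘ f.
Proof. by move=> ->. Qed.

Lemma comp_congr X Y Z (g : hom Y Z) (f f' : hom X Y) :
  f = f' -> g ∘ f = g ∘ f'.
Proof. by move=> ->. Qed.

Lemma lwhisk_comp X Y Y' Y'' (g : hom Y' Y'') (f : hom Y Y') :
  idm X ⊠ (g ∘ f) = (idm X ⊠ g) ∘ (idm X ⊠ f).
Proof. by rewrite -tensm_comp comp1m. Qed.

Lemma rwhisk_comp X Y Y' Y'' (g : hom Y' Y'') (f : hom Y Y') :
  (g ∘ f) ⊠ idm X = (g ⊠ idm X) ∘ (f ⊠ idm X).
Proof. by rewrite -tensm_comp comp1m. Qed.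

Lemma whisk_exch X X' Y Y' (f : hom X X') (g : hom Y Y') :
  (f ⊠ idm Y') ∘ (idm X ⊠ g) = (idm X' ⊠ g) ∘ (f ⊠ idm Y).
Proof. by rewrite -!tensm_comp !comp1m !compm1. Qed.

Lemma assoc_inv_nat X Y Z X' Y' Z' (f : hom X X') (g : hom Y Y')
    (h : hom Z Z') :
  assoc_inv X' Y' Z' ∘ (f ⊠ (g ⊠ h)) = ((f ⊠ g) ⊠ h) ∘ assoc_inv X Y Z.
Proof.
rewrite -[LHS]compm1 -(assoc_invK X Y Z) compA -(compA _ _ (assoc X Y Z)).
by rewrite -assoc_nat compA assocK comp1m.
Qed.

Lemma assoc_epi X Y Z W (f g : hom (X ⊗ (Y ⊗ Z)) W) :
  f ∘ assoc X Y Z = g ∘ assoc X Y Z -> f = g.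
Proof.
move=> /(@comp_congl _ _ _ _ _ (assoc_inv X Y Z)).
by rewrite -!compA assoc_invK !compm1.
Qed.

Lemma assoc_mono X Y Z W (f g : hom W ((X ⊗ Y) ⊗ Z)) :
  assoc X Y Z ∘ f = assoc X Y Z ∘ g -> f = g.
Proof.
move=> /(@comp_congr _ _ _ (assoc_inv X Y Z)).
by rewrite !compA assocK !comp1m.
Qed.

Lemma assocI_epi X Y Z U W (f g : hom ((X ⊗ (Y ⊗ Z)) ⊗ U) W) :
  f ∘ (assoc X Y Z ⊠ idm U) = g ∘ (assoc X Y Z ⊠ idm U) -> f = g.
Proof.
move=> /(@comp_congl _ _ _ _ _ (assoc_inv X Y Z ⊠ idm U)).
by rewrite -!compA -!rwhisk_comp assoc_invK tensm1 !compm1.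
Qed.

Lemma pentagon_inv X Y Z W :
  assoc_inv X Y (Z ⊗ W) ∘ (idm X ⊠ assoc Y Z W) ∘ assoc X (Y ⊗ Z) W =
  assoc (X ⊗ Y) Z W ∘ (assoc_inv X Y Z ⊠ idm W).
Proof.
apply: assocI_epi.
rewrite -!compA (compA (idm X ⊠ _)) -pentagon compA assocK comp1m.
by rewrite -rwhisk_comp assocK tensm1 compm1.
Qed.

Lemma pentagon_inv2 X Y Z W :
  assoc_inv X (Y ⊗ Z) W ∘ (idm X ⊠ assoc_inv Y Z W) ∘ assoc X Y (Z ⊗ W) =
  (assoc X Y Z ⊠ idm W) ∘ assoc_inv (X ⊗ Y) Z W.
Proof.
apply: assoc_epi.
rewrite -!compA assocK compm1 pentagon !compA -(compA (assoc_inv _ _ _)).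
by rewrite -lwhisk_comp assocK tensm1 compm1 assocK comp1m.
Qed.

Lemma unitI_faithful X Y (f g : hom X Y) :
  idm (unit_obj C) ⊠ f = idm (unit_obj C) ⊠ g -> f = g.
Proof.
move=> /(@comp_congr _ _ _ (lunit Y)).
rewrite !lunit_nat => /(@comp_congl _ _ _ _ _ (lunit_inv X)).
by rewrite -!compA lunit_invK !compm1.
Qed.

Lemma Iunit_faithful X Y (f g : hom X Y) :
  f ⊠ idm (unit_obj C) = g ⊠ idm (unit_obj C) -> f = g.
Proof.
move=> /(@comp_congr _ _ _ (runit Y)).
rewrite !runit_nat => /(@comp_congl _ _ _ _ _ (runit_inv X)).
by rewrite -!compA runit_invK !compm1.
Qed.

Lemma lunit_tens X Y :
  lunit (X ⊗ Y) ∘ assoc (unit_obj C) X Y = lunit X ⊠ idm Y.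
Proof.
apply: unitI_faithful; rewrite lwhisk_comp.
apply: assoc_epi; apply: assocI_epi.
rewrite -!compA (compA (idm _ ⊠ assoc _ _ _)) -pentagon compA triangle.
rewrite -tensm1 -assoc_nat compA -assoc_nat -compA -rwhisk_comp.
by rewrite triangle.
Qed.

Lemma lunit_tens_inv X Y :
  (lunit X ⊠ idm Y) ∘ assoc_inv (unit_obj C) X Y = lunit (X ⊗ Y).
Proof. by rewrite -lunit_tens -compA assoc_invK compm1. Qed.

Lemma runit_tens X Y :
  (idm X ⊠ runit Y) ∘ assoc X Y (unit_obj C) = runit (X ⊗ Y).
Proof.
apply: Iunit_faithful; rewrite rwhisk_comp.
apply: assoc_mono.
rewrite compA assoc_nat -triangle lwhisk_comp -!compA.
rewrite (compA (idm _ ⊠ assoc _ _ _)) -pentagon compA.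
by rewrite -assoc_nat tensm1 -compA triangle.
Qed.

End MonoidalLemmas.

Record coflat (C : monoidal_category) (X : C) : Prop := Coflat {
  coflat_l : forall (U V Q : C) (f g : hom U V) (q : hom V Q),
    is_coequalizer f g q ->
    is_coequalizer (idm X ⊠ f) (idm X ⊠ g) (idm X ⊠ q);
  coflat_r : forall (U V Q : C) (f g : hom U V) (q : hom V Q),
    is_coequalizer f g q ->
    is_coequalizer (f ⊠ idm X) (g ⊠ idm X) (q ⊠ idm X)
}.

Definition left_tensor_generator (C : monoidal_category) (P : C) : Prop :=
  forall (Y Z W : C) (f g : hom (Y ⊗ Z) W),
    (forall epsilon : hom P Y, f ∘ (epsilon ⊠ idm Z) = g ∘ (epsilon ⊠ idm Z)) ->
    f = g.

Record algebra (C : monoidal_category) := Algebra {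
  alg_obj :> C;
  mul : hom (alg_obj ⊗ alg_obj) alg_obj;
  one : hom (unit_obj C) alg_obj;
  mul_assoc : mul ∘ (mul ⊠ idm alg_obj) =
    mul ∘ (idm alg_obj ⊠ mul) ∘ assoc alg_obj alg_obj alg_obj;
  mul_1l : mul ∘ (one ⊠ idm alg_obj) = lunit alg_obj;
  mul_1r : mul ∘ (idm alg_obj ⊠ one) = runit alg_obj
}.

Arguments mul {C} a.
Arguments one {C} a.

Record left_module (C : monoidal_category) (A : algebra C) := LeftModule {
  lmod_obj :> C;
  lact : hom (A ⊗ lmod_obj) lmod_obj;
  lact_mul : lact ∘ (mul A ⊠ idm lmod_obj) =
    lact ∘ (idm A ⊠ lact) ∘ assoc A A lmod_obj;
  lact_1 : lact ∘ (one A ⊠ idm lmod_obj) = lunit lmod_obj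
}.

Arguments lact {C A} l.

Record right_module (C : monoidal_category) (A : algebra C) := RightModule {
  rmod_obj :> C;
  ract : hom (rmod_obj ⊗ A) rmod_obj;
  ract_mul : ract ∘ (ract ⊠ idm A) =
    ract ∘ (idm rmod_obj ⊠ mul A) ∘ assoc rmod_obj A A;
  ract_1 : ract ∘ (idm rmod_obj ⊠ one A) = runit rmod_obj
}.

Arguments ract {C A} r.

Record bimodule (C : monoidal_category) (A : algebra C) := Bimodule {
  bimod_left :> left_module A;
  bract : hom (bimod_left ⊗ A) bimod_left;
  bract_mul : bract ∘ (bract ⊠ idm A) =
    bract ∘ (idm bimod_left ⊠ mul A) ∘ assoc bimod_left A A;
  bract_1 : bract ∘ (idm bimod_left ⊠ one A) = runit bimod_left;
  bimod_compat : bract ∘ (lact bimod_left ⊠ idm A) =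
    lact bimod_left ∘ (idm A ⊠ bract) ∘ assoc A bimod_left A
}.

Arguments bract {C A} b.

Definition bimodule_morphism (C : monoidal_category) (A : algebra C)
    (X Y : bimodule A) (f : hom X Y) : Prop :=
  f ∘ lact X = lact Y ∘ (idm A ⊠ f) /\ f ∘ bract X = bract Y ∘ (f ⊠ idm A).

Record algebra_morphism (C : monoidal_category) (R S : algebra C) :=
  AlgebraMorphism {
    alg_map :> hom R S;
    alg_map_mul : alg_map ∘ mul R = mul S ∘ (alg_map ⊠ alg_map);
    alg_map_one : alg_map ∘ one R = one S
  }.

Section Modules.

Variable C : monoidal_category.

Definition regular_left (A : algebra C) : left_module A :=
  LeftModule (mul_assoc A) (mul_1l A).

Definition regular_right (A : algebra C) : right_module A :=
  RightModule (mul_assoc A) (mul_1r A).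

Definition regular_bimodule (A : algebra C) : bimodule A :=
  @Bimodule C A (regular_left A) (mul A) (mul_assoc A) (mul_1r A) (mul_assoc A).

Section LeftTensor.

Variables (A : algebra C) (X : left_module A) (M : C).

Definition ltens_act : hom (A ⊗ (X ⊗ M)) (X ⊗ M) :=
  (lact X ⊠ idm M) ∘ assoc_inv A X M.

Lemma ltens_act_mul : ltens_act ∘ (mul A ⊠ idm (X ⊗ M)) =
  ltens_act ∘ (idm A ⊠ ltens_act) ∘ assoc A A (X ⊗ M).
Proof.
rewrite /ltens_act -tensm1 -compA assoc_inv_nat compA -rwhisk_comp lact_mul.
rewrite !rwhisk_comp lwhisk_comp -!compA -pentagon_inv2.
by rewrite !compA -(compA _ (assoc_inv A X M)) assoc_inv_nat !compA.
Qed.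

Lemma ltens_act_1 : ltens_act ∘ (one A ⊠ idm (X ⊗ M)) = lunit (X ⊗ M).
Proof.
rewrite /ltens_act -tensm1 -compA assoc_inv_nat compA -rwhisk_comp lact_1.
exact: lunit_tens_inv.
Qed.

(** [X ⊗ M] as a left [A]-module, through [X]. *)
Definition ltens_module : left_module A := LeftModule ltens_act_mul ltens_act_1.

End LeftTensor.

Section RightTensor.

Variables (A : algebra C) (M : C) (X : right_module A).

Definition rtens_act : hom ((M ⊗ X) ⊗ A) (M ⊗ X) :=
  (idm M ⊠ ract X) ∘ assoc M X A.

Lemma rtens_act_mul : rtens_act ∘ (rtens_act ⊠ idm A) =
  rtens_act ∘ (idm (M ⊗ X) ⊠ mul A) ∘ assoc (M ⊗ X) A A.
Proof.
rewrite /rtens_act -tensm1 rwhisk_comp -!compA.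
rewrite (compA (assoc M X A)) assoc_nat.
rewrite (compA (assoc M X A)) assoc_nat -!compA pentagon.
by rewrite !compA -!lwhisk_comp ract_mul.
Qed.

Lemma rtens_act_1 : rtens_act ∘ (idm (M ⊗ X) ⊠ one A) = runit (M ⊗ X).
Proof.
rewrite /rtens_act -tensm1 -compA assoc_nat compA -lwhisk_comp ract_1.
exact: runit_tens.
Qed.

(** [M ⊗ X] as a right [A]-module, through [X]. *)
Definition rtens_module : right_module A :=
  RightModule rtens_act_mul rtens_act_1.

End RightTensor.

Lemma square_compat (A : algebra C) :
  rtens_act A (regular_right A) ∘ (ltens_act (regular_left A) A ⊠ idm A) =
  ltens_act (regular_left A) A ∘ (idm A ⊠ rtens_act A (regular_right A)) ∘
    assoc A (A ⊗ A) A.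
Proof.
rewrite /rtens_act /ltens_act /= rwhisk_comp lwhisk_comp.
rewrite -!compA (compA (assoc A A A)) assoc_nat tensm1.
rewrite (compA (assoc_inv A A A)) assoc_inv_nat tensm1.
rewrite !compA -whisk_exch -!compA; do 2!apply: comp_congr.
by rewrite !compA pentagon_inv.
Qed.

(** The [A]-bimodule [A ⊗ A], with outer actions. *)
Definition square_bimodule (A : algebra C) : bimodule A :=
  @Bimodule C A (ltens_module (regular_left A) A)
    (rtens_act A (regular_right A))
    (rtens_act_mul A (regular_right A)) (rtens_act_1 A (regular_right A))
    (square_compat A).

Definition separable (A : algebra C) : Prop :=
  exists gamma : hom A (A ⊗ A),
    @bimodule_morphism C A (regular_bimodule A) (square_bimodule A) gamma /\
    mul A ∘ gamma = idm A.

Section Restriction.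

Variables (R S : algebra C) (i : algebra_morphism R S).

Lemma res_left_mul (X : left_module S) :
  lact X ∘ (i ⊠ idm X) ∘ (mul R ⊠ idm X) =
  lact X ∘ (i ⊠ idm X) ∘ (idm R ⊠ (lact X ∘ (i ⊠ idm X))) ∘ assoc R R X.
Proof.
rewrite -!compA -rwhisk_comp alg_map_mul rwhisk_comp compA lact_mul.
rewrite -!compA assoc_nat; apply: comp_congr.
by rewrite !compA -!tensm_comp !comp1m !compm1.
Qed.

Lemma res_left_1 (X : left_module S) :
  lact X ∘ (i ⊠ idm X) ∘ (one R ⊠ idm X) = lunit X.
Proof. by rewrite -compA -rwhisk_comp alg_map_one lact_1. Qed.

Definition res_left (X : left_module S) : left_module R :=
  LeftModule (res_left_mul X) (res_left_1 X).

Lemma res_right_mul (X : right_module S) :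
  ract X ∘ (idm X ⊠ i) ∘ ((ract X ∘ (idm X ⊠ i)) ⊠ idm R) =
  ract X ∘ (idm X ⊠ i) ∘ (idm X ⊠ mul R) ∘ assoc X R R.
Proof.
rewrite -(compA _ _ (idm X ⊠ mul R)) -lwhisk_comp alg_map_mul lwhisk_comp.
rewrite -!compA -assoc_nat !compA -ract_mul -!compA; apply: comp_congr.
by rewrite -!tensm_comp !comp1m !compm1.
Qed.

Lemma res_right_1 (X : right_module S) :
  ract X ∘ (idm X ⊠ i) ∘ (idm X ⊠ one R) = runit X.
Proof. by rewrite -compA -lwhisk_comp alg_map_one ract_1. Qed.

Definition res_right (X : right_module S) : right_module R :=
  RightModule (res_right_mul X) (res_right_1 X).

End Restriction.

End Modules.

Section TensorOver.

Variables (C : monoidal_category) (coeqs : coequalizers C).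

Section Def.

Variables (R : algebra C) (X : right_module R) (Y : left_module R).

Definition over_l : hom ((X ⊗ R) ⊗ Y) (X ⊗ Y) := ract X ⊠ idm Y.

Definition over_r : hom ((X ⊗ R) ⊗ Y) (X ⊗ Y) :=
  (idm X ⊠ lact Y) ∘ assoc X R Y.

Definition tens_over : C := coeq_obj (coeqs over_l over_r).

Definition tens_over_proj : hom (X ⊗ Y) tens_over :=
  coeq_map (coeqs over_l over_r).

Definition tens_overP : is_coequalizer over_l over_r tens_over_proj :=
  coeqP (coeqs over_l over_r).

End Def.

Section Robust.

Variables (R : algebra C) (M : C) (X : right_module R) (Y : left_module R).

Lemma theta_cond :
  (idm M ⊠ tens_over_proj X Y) ∘ assoc M X Y ∘ over_l (rtens_module M X) Y =
  (idm M ⊠ tens_over_proj X Y) ∘ assoc M X Y ∘ over_r (rtens_module M X) Y.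
Proof.
have E := coeq_cond (tens_overP X Y).
rewrite /over_l /over_r /= /rtens_act -tensm1 rwhisk_comp in E *.
rewrite -!compA (compA (assoc M X Y)) assoc_nat.
rewrite (compA (assoc M X Y)) assoc_nat -!compA pentagon.
by rewrite !compA -!lwhisk_comp E !compA.
Qed.

(** The canonical morphism [(M ⊗ X) ⊗_R Y -> M ⊗ (X ⊗_R Y)]. *)
Definition theta :
    hom (tens_over (rtens_module M X) Y) (M ⊗ tens_over X Y) :=
  coeq_desc (tens_overP (rtens_module M X) Y) theta_cond.

End Robust.

Definition left_robust (R : algebra C) (Y : left_module R) : Prop :=
  forall (M : C) (X : right_module R), is_iso (theta M X Y).

Section Extension.

Variables (R S : algebra C) (i : algebra_morphism R S).

Let SR : right_module R := res_right i (regular_right S).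
Let RS : left_module R := res_left i (regular_left S).

(** [S ⊗_R S] *)
Definition ext_square : C := tens_over SR RS.

Definition ext_proj : hom (S ⊗ S) ext_square := tens_over_proj SR RS.

Lemma ext_mul_cond : mul S ∘ over_l SR RS = mul S ∘ over_r SR RS.
Proof.
rewrite /over_l /over_r /= rwhisk_comp lwhisk_comp compA mul_assoc.
by rewrite -!compA assoc_nat.
Qed.

Definition ext_mul : hom ext_square S :=
  coeq_desc (tens_overP SR RS) ext_mul_cond.

Lemma res_right_mull :
  ract SR ∘ (mul S ⊠ idm R) = mul S ∘ (idm S ⊠ ract SR) ∘ assoc S S R.
Proof.
rewrite /= lwhisk_comp -!compA -whisk_exch -assoc_nat tensm1.
by rewrite !compA mul_assoc.
Qed.

Lemma res_left_mulr :
  mul S ∘ (lact RS ⊠ idm S) = lact RS ∘ (idm R ⊠ mul S) ∘ assoc R S S.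
Proof.
rewrite /= rwhisk_comp -!compA (compA (i ⊠ idm S)) whisk_exch -!compA -tensm1.
by rewrite -assoc_nat !compA mul_assoc.
Qed.

Section Actions.

Hypothesis flatS : coflat S.

Lemma ext_lact_cond :
  ext_proj ∘ (mul S ⊠ idm S) ∘ assoc_inv S S S ∘ (idm S ⊠ over_l SR RS) =
  ext_proj ∘ (mul S ⊠ idm S) ∘ assoc_inv S S S ∘ (idm S ⊠ over_r SR RS).
Proof.
have E := coeq_cond (tens_overP SR RS); rewrite -/ext_proj in E.
rewrite /over_l /over_r in E *; move: E res_right_mull.
move: (ract SR) (lact RS) => /= nu mu E H.
rewrite -(compA _ (assoc_inv S S S)) assoc_inv_nat.
rewrite -(compA ext_proj) (compA (mul S ⊠ idm S)) -rwhisk_comp.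
have -> : mul S ∘ (idm S ⊠ nu) = nu ∘ (mul S ⊠ idm R) ∘ assoc_inv S S R.
  by rewrite H -!compA assoc_invK compm1.
rewrite !rwhisk_comp !compA E lwhisk_comp -!compA; apply: comp_congr.
rewrite (compA (assoc S R S)) assoc_nat tensm1.
rewrite (compA (assoc_inv S S S)) assoc_inv_nat tensm1.
rewrite !compA -whisk_exch whisk_exch -!compA.
do 2!apply: comp_congr; rewrite compA -pentagon_inv.
by rewrite -!compA assoc_invK compm1.
Qed.

(** By coflatness [idm S ⊠ ext_proj] and [ext_proj ⊠ idm S] are again
    coequalizers, which defines the two outer actions of [S] on [S ⊗_R S]. *)
Definition ext_lact : hom (S ⊗ ext_square) ext_square :=
  coeq_desc (coflat_l flatS (tens_overP SR RS)) ext_lact_cond.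

Lemma ext_ract_cond :
  ext_proj ∘ (idm S ⊠ mul S) ∘ assoc S S S ∘ (over_l SR RS ⊠ idm S) =
  ext_proj ∘ (idm S ⊠ mul S) ∘ assoc S S S ∘ (over_r SR RS ⊠ idm S).
Proof.
have E := coeq_cond (tens_overP SR RS); rewrite -/ext_proj in E.
rewrite /over_l /over_r in E *; move: E res_left_mulr.
move: (ract SR) (lact RS) => /= nu mu E H.
rewrite -!(compA _ (assoc S S S)) assoc_nat tensm1 rwhisk_comp.
rewrite (compA (assoc S S S)) assoc_nat -!compA.
rewrite (compA (idm S ⊠ mul S)) -whisk_exch.
rewrite !compA E -!(compA ext_proj) -!lwhisk_comp H.
rewrite -!compA -tensm1 (compA (assoc S R S)) assoc_nat -!compA pentagon.
by rewrite !lwhisk_comp -!compA.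
Qed.

Definition ext_ract : hom (ext_square ⊗ S) ext_square :=
  coeq_desc (coflat_r flatS (tens_overP SR RS)) ext_ract_cond.

Definition separable_extension : Prop :=
  exists e : hom (unit_obj C) ext_square,
    ext_lact ∘ (idm S ⊠ e) ∘ runit_inv S =
      ext_ract ∘ (e ⊠ idm S) ∘ lunit_inv S /\
    ext_mul ∘ e = one S.

End Actions.

End Extension.

End TensorOver.

(* Main.v *)
(** Call [w : 1 -> M], with [M] an [A]-bimodule, central if [a w = w a].  An
    algebra [A] is separable iff some central [w : 1 -> A ⊗ A] is mapped to the
    unit by multiplication.  If [w] is such an element for [S], its image in
    [S ⊗_R S] makes the extension separable.  Conversely, if [a ⊗ b] is such an
    element for [R], then [x ⊗ y |-> x i(a) ⊗ i(b) y] is [R]-balanced and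
    induces a morphism of [S]-bimodules [S ⊗_R S -> S ⊗ S] compatible with
    multiplication; it carries a separability element of the extension to one
    of [S]. *)
From Corelib Require Import ssreflect.
Require Import Defs.

Set Implicit Arguments.
Unset Strict Implicit.
Unset Printing Implicit Defensive.

Local Open Scope cat_scope.

Lemma coequalizer_epi (C : category) (X Y Q : C) (f g : hom X Y) (q : hom Y Q) :
  is_coequalizer f g q -> epi q.
Proof.
move=> [Hq U] Z a b E.
have Hb : b ∘ q ∘ f = b ∘ q ∘ g by rewrite -!compA Hq.
have [k [_ Hk]] := U _ _ Hb.
by rewrite -(Hk _ E) -(Hk b).
Qed.

(** * Orbits of elements [1 -> M] and the central form of separability *)

Section Elements.

Variable C : monoidal_category.
Implicit Types X Y Z : C.

Lemma lunit_inv_nat X Y (f : hom X Y) :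
  lunit_inv Y ∘ f = (idm (unit_obj C) ⊠ f) ∘ lunit_inv X.
Proof.
rewrite -[LHS]compm1 -(lunit_invK X) compA -(compA _ f) -lunit_nat.
by rewrite !compA lunitK comp1m.
Qed.

Lemma runit_inv_nat X Y (f : hom X Y) :
  runit_inv Y ∘ f = (f ⊠ idm (unit_obj C)) ∘ runit_inv X.
Proof.
rewrite -[LHS]compm1 -(runit_invK X) compA -(compA _ f) -runit_nat.
by rewrite !compA runitK comp1m.
Qed.

Lemma runit_inv_tens X Y :
  assoc X Y (unit_obj C) ∘ runit_inv (X ⊗ Y) = idm X ⊠ runit_inv Y.
Proof.
have E : (idm X ⊠ runit_inv Y) ∘ (idm X ⊠ runit Y) = idm _.
  by rewrite -lwhisk_comp runitK tensm1.
rewrite -[LHS]comp1m -E -(compA (idm X ⊠ runit_inv Y)).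
by rewrite (compA (idm X ⊠ runit Y)) runit_tens runit_invK compm1.
Qed.

Lemma lunit_inv_tens X Y :
  assoc (unit_obj C) X Y ∘ (lunit_inv X ⊠ idm Y) = lunit_inv (X ⊗ Y).
Proof.
rewrite -[LHS]comp1m -lunitK -!compA (compA (lunit _)) lunit_tens.
by rewrite -rwhisk_comp lunit_invK tensm1 compm1.
Qed.

Lemma triangle_inv X Y :
  assoc X (unit_obj C) Y ∘ (runit_inv X ⊠ idm Y) = idm X ⊠ lunit_inv Y.
Proof.
have E : (idm X ⊠ lunit_inv Y) ∘ (idm X ⊠ lunit Y) = idm _.
  by rewrite -lwhisk_comp lunitK tensm1.
rewrite -[LHS]comp1m -E -!compA (compA (idm X ⊠ lunit Y)) triangle.
by rewrite -rwhisk_comp runit_invK tensm1 compm1.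
Qed.

Variable A : algebra C.

(** In element notation [lorbit w] is [a |-> a w], and [rorbit w] below is [a |-> w a]. *)
Definition lorbit (M : left_module A) (w : hom (unit_obj C) M) : hom A M :=
  lact M ∘ (idm A ⊠ w) ∘ runit_inv A.

Definition rorbit (M : bimodule A) (w : hom (unit_obj C) M) : hom A M :=
  bract M ∘ (w ⊠ idm A) ∘ lunit_inv A.

(** Associativity of the action, [(a b) w = a (b w)], makes [lorbit w] left linear for any [w]. *)
Lemma lorbit_mul (M : left_module A) (w : hom (unit_obj C) M) :
  lorbit w ∘ mul A = lact M ∘ (idm A ⊠ lorbit w).
Proof.
rewrite /lorbit -!compA runit_inv_nat (compA (idm A ⊠ w)).
rewrite -whisk_exch !compA lact_mul -!compA !lwhisk_comp.
rewrite -tensm1 (compA (assoc _ _ _)) assoc_nat -!compA.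
by rewrite runit_inv_tens.
Qed.

Lemma rorbit_mul (M : bimodule A) (w : hom (unit_obj C) M) :
  rorbit w ∘ mul A = bract M ∘ (rorbit w ⊠ idm A).
Proof.
rewrite /rorbit -!compA lunit_inv_nat (compA (w ⊠ idm A)).
rewrite whisk_exch !rwhisk_comp !compA bract_mul -!compA.
rewrite (compA (assoc _ _ _)) assoc_nat -!compA tensm1.
by rewrite lunit_inv_tens.
Qed.

(** Associativity, read as linearity of [mul A] for the outer left action on [A ⊗ A]. *)
Lemma mul_lsquare :
  mul A ∘ ltens_act (regular_left A) A = mul A ∘ (idm A ⊠ mul A).
Proof.
by rewrite /ltens_act /= compA mul_assoc -compA assoc_invK compm1.
Qed.

Lemma mul_rsquare :
  mul A ∘ rtens_act A (regular_right A) = mul A ∘ (mul A ⊠ idm A).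
Proof. by rewrite /rtens_act /= compA -mul_assoc. Qed.

Lemma mul_lorbit_square (w : hom (unit_obj C) (A ⊗ A)) :
  mul A ∘ w = one A ->
  mul A ∘ lorbit (M := square_bimodule A) w = idm A.
Proof.
move=> w1; rewrite /lorbit 2!(compA (mul A)) /= mul_lsquare.
by rewrite -(compA (mul A)) -lwhisk_comp w1 mul_1r runit_invK.
Qed.

Definition central (M : bimodule A) (w : hom (unit_obj C) M) : Prop :=
  lorbit w = rorbit w.

(** A bimodule section [gamma] is determined by [w = gamma(1)], since [a w = gamma(a) = w a]. *)
Lemma separable_central :
  separable A <-> exists w : hom (unit_obj C) (A ⊗ A),
    central (M := square_bimodule A) w /\ mul A ∘ w = one A.
Proof.
split=> [[g [[gl gr] g1]]|[w [cw w1]]].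
  exists (g ∘ one A); split; last by rewrite compA g1 comp1m.
  rewrite /central /lorbit /rorbit lwhisk_comp rwhisk_comp !compA -gl -gr /=.
  rewrite -(compA g) -(compA g _ (one A ⊠ _)) mul_1l mul_1r.
  by rewrite -!compA lunit_invK runit_invK.
(* [lorbit w] is left linear and [rorbit w] right linear; centrality identifies them. *)
exists (lorbit (M := square_bimodule A) w); split.
  split; first exact: lorbit_mul.
  by rewrite cw; exact: rorbit_mul.
exact: mul_lorbit_square.
Qed.

(** With [v] an element of [M], this is [x ⊗ y |-> x v y]. *)
Definition sandwich (M : bimodule A) (v : hom (unit_obj C) M) :
    hom (A ⊗ A) M :=
  bract M ∘ (lorbit v ⊠ idm A).

(** The two bracketings [(x v) y = x (v y)] agree because the actions on [M] commute. *)
Lemma sandwichE (M : bimodule A) (v : hom (unit_obj C) M) :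
  sandwich v = lact M ∘ (idm A ⊠ rorbit v).
Proof.
rewrite /sandwich /lorbit !rwhisk_comp !compA bimod_compat.
rewrite -!compA (compA (assoc _ _ _)) assoc_nat -!compA triangle_inv.
by rewrite /rorbit !lwhisk_comp !compA.
Qed.

Lemma sandwich_lact (M : bimodule A) (v : hom (unit_obj C) M) :
  sandwich v ∘ ltens_act (regular_left A) A = lact M ∘ (idm A ⊠ sandwich v).
Proof.
rewrite /sandwich /ltens_act /= -!compA (compA (lorbit v ⊠ _)).
rewrite -rwhisk_comp lorbit_mul rwhisk_comp !compA bimod_compat lwhisk_comp.
rewrite -!compA (compA (assoc _ _ _)) assoc_nat -!compA.
by rewrite assoc_invK compm1.
Qed.

Lemma sandwich_ract (M : bimodule A) (v : hom (unit_obj C) M) :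
  sandwich v ∘ rtens_act A (regular_right A) =
  bract M ∘ (sandwich v ⊠ idm A).
Proof.
rewrite /sandwich /rtens_act /= -!compA (compA (lorbit v ⊠ _)).
rewrite whisk_exch rwhisk_comp !compA bract_mul -!compA.
by rewrite assoc_nat tensm1.
Qed.

(** If [v] is [a ⊗ b] with [a b = 1], then [(x a) (b y) = x y]. *)
Lemma mul_sandwich_square (v : hom (unit_obj C) (A ⊗ A)) :
  mul A ∘ v = one A -> mul A ∘ sandwich (M := square_bimodule A) v = mul A.
Proof.
move=> v1; rewrite /sandwich compA /= mul_rsquare -compA -rwhisk_comp.
by rewrite mul_lorbit_square // tensm1 compm1.
Qed.

End Elements.

(** * Passing between [S ⊗_R S] and [S ⊗ S] *)

Section Extension.

Variables (C : monoidal_category) (R S : algebra C) (i : algebra_morphism R S).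

Lemma lorbit_square_map (w : hom (unit_obj C) (R ⊗ R)) :
  lorbit (M := square_bimodule S) ((i ⊠ i) ∘ w) ∘ i =
  (i ⊠ i) ∘ lorbit (M := square_bimodule R) w.
Proof.
rewrite /lorbit /= /ltens_act /= -!compA runit_inv_nat.
rewrite (compA (idm S ⊠ _)) -whisk_exch lwhisk_comp !compA.
do 2!apply: comp_congl.
rewrite -!compA -!tensm_comp comp1m compm1 assoc_inv_nat.
by rewrite !compA -!tensm_comp !comp1m compm1 alg_map_mul.
Qed.

Lemma rorbit_square_map (w : hom (unit_obj C) (R ⊗ R)) :
  rorbit (M := square_bimodule S) ((i ⊠ i) ∘ w) ∘ i =
  (i ⊠ i) ∘ rorbit (M := square_bimodule R) w.
Proof.
rewrite /rorbit /= /rtens_act /= -!compA lunit_inv_nat.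
rewrite (compA (_ ⊠ idm S)) whisk_exch rwhisk_comp !compA.
do 2!apply: comp_congl.
rewrite -!compA -tensm_comp comp1m compm1 assoc_nat.
by rewrite !compA -!tensm_comp comp1m compm1 -alg_map_mul.
Qed.

(** The image of [w] is only shown to commute with [i(R)], not with all of [S]; this suffices for
    balancedness over [R]. *)
Lemma central_square_map (w : hom (unit_obj C) (R ⊗ R)) :
  central (M := square_bimodule R) w ->
  lorbit (M := square_bimodule S) ((i ⊠ i) ∘ w) ∘ i =
  rorbit (M := square_bimodule S) ((i ⊠ i) ∘ w) ∘ i.
Proof. by move=> cw; rewrite lorbit_square_map cw rorbit_square_map. Qed.

Lemma sandwich_balanced (M : bimodule S) (v : hom (unit_obj C) M) :
  lorbit v ∘ i = rorbit v ∘ i ->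
  sandwich v ∘ over_l (res_right i (regular_right S))
                      (res_left i (regular_left S)) =
  sandwich v ∘ over_r (res_right i (regular_right S))
                      (res_left i (regular_left S)).
Proof.
move=> cv; rewrite /over_l /over_r /=.
(* Here [(x i(r)) v y = x (i(r) v) y = x (v i(r)) y], the middle equality being [cv]. *)
have -> : sandwich v ∘ ((mul S ∘ (idm S ⊠ i)) ⊠ idm S) =
    bract M ∘ (sandwich v ⊠ idm S) ∘ ((idm S ⊠ i) ⊠ idm S).
  rewrite {1}/sandwich -!compA -!rwhisk_comp compA lorbit_mul sandwichE.
  by rewrite -!compA -!lwhisk_comp cv.
rewrite -sandwich_ract /rtens_act /= -!compA assoc_nat.
by rewrite lwhisk_comp !compA.
Qed.

Variables (coeqs : coequalizers C) (flatS : coflat S).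

Local Notation ext_proj := (ext_proj coeqs i).
Local Notation ext_lact := (ext_lact coeqs i flatS).
Local Notation ext_ract := (ext_ract coeqs i flatS).
Local Notation ext_mul := (ext_mul coeqs i).

Lemma ext_lact_proj :
  ext_lact ∘ (idm S ⊠ ext_proj) = ext_proj ∘ ltens_act (regular_left S) S.
Proof. by rewrite [LHS]coeq_descE /ltens_act compA. Qed.

Lemma ext_ract_proj :
  ext_ract ∘ (ext_proj ⊠ idm S) = ext_proj ∘ rtens_act S (regular_right S).
Proof. by rewrite [LHS]coeq_descE /rtens_act compA. Qed.

Lemma ext_mul_proj : ext_mul ∘ ext_proj = mul S.
Proof. exact: coeq_descE. Qed.

Lemma separable_separable_extension :
  separable S -> separable_extension coeqs i flatS.
Proof.
move=> /separable_central[w [cw w1]].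
(* [ext_proj] respects both actions of [S], so it preserves centrality. *)
exists (ext_proj ∘ w); split; last by rewrite compA ext_mul_proj.
rewrite lwhisk_comp rwhisk_comp !(compA ext_lact) !(compA ext_ract).
rewrite ext_lact_proj ext_ract_proj -!(compA ext_proj).
by congr (ext_proj ∘ _); exact: cw.
Qed.

Lemma separable_extension_separable :
  separable R -> separable_extension coeqs i flatS -> separable S.
Proof.
move=> /separable_central[w [cw w1]] [e [ce e1]].
pose v : hom (unit_obj C) (square_bimodule S) := (i ⊠ i) ∘ w.
have v1 : mul S ∘ v = one S.
  by rewrite /v compA -alg_map_mul -compA w1 alg_map_one.
have bal := sandwich_balanced (central_square_map cw).
pose s := coeq_desc (tens_overP coeqs _ _) bal.
have sq : s ∘ ext_proj = sandwich v by exact: coeq_descE.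
have P := tens_overP coeqs (res_right i (regular_right S))
                           (res_left i (regular_left S)).
have sl : s ∘ ext_lact = lact (square_bimodule S) ∘ (idm S ⊠ s).
  (* By coflatness [idm S ⊠ ext_proj] is epi, so linearity of [s] reduces to that of
     [sandwich v]. *)
  apply: (coequalizer_epi (coflat_l flatS P)).
  rewrite -(compA s) -(compA (lact _)) -lwhisk_comp sq -sandwich_lact -sq -compA.
  by congr (s ∘ _); exact: ext_lact_proj.
have sr : s ∘ ext_ract = bract (square_bimodule S) ∘ (s ⊠ idm S).
  apply: (coequalizer_epi (coflat_r flatS P)).
  rewrite -(compA s) -(compA (bract _)) -rwhisk_comp sq -sandwich_ract -sq -compA.
  by congr (s ∘ _); exact: ext_ract_proj.
have sm : mul S ∘ s = ext_mul.
  apply: (coequalizer_epi P).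
  rewrite -compA sq [RHS]ext_mul_proj.
  exact: mul_sandwich_square.
(* The condition [ce] says that [e] is central in [S ⊗_R S]; [s] transports it by [sl] and [sr]. *)
apply/separable_central; exists (s ∘ e); split; last by rewrite compA sm.
rewrite /central /lorbit /rorbit lwhisk_comp rwhisk_comp.
rewrite !(compA (lact _)) !(compA (bract _)) -sl -sr -!(compA s).
by rewrite ce.
Qed.

End Extension.

Theorem corollary4p8 (C : monoidal_category) (coeqs : coequalizers C)
  (all_coflat : forall X : C, coflat X)
  (all_robust : forall (R : algebra C) (Y : left_module R),
    left_robust coeqs Y)
  (unit_cond : projective (unit_obj C) \/ left_tensor_generator (unit_obj C))
  (R S : algebra C) (i : algebra_morphism R S) (sepR : separable R) :
  separable S <-> separable_extension coeqs i (all_coflat S).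
Proof.
split; first exact: separable_separable_extension.
exact: separable_extension_separable.
Qed.
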